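(* Let $n\ge 1$ and $w\in S_n$. Then, as an identity in $\mathbb Z[\beta^{\pm1}][x_1,\dots,x_n;y_1,\dots,y_n]$, $$\mathfrak G^{(\beta)}_w(\mathbf x;\mathbf y)=\beta^{-\ell(w)}\sum_{\mathcal P\in \mathsf{Pipes}(w)}\mathrm{wt}(\mathcal P).$$
   Context: Permutations $w\in S_n$ are written in one-line notation $w=w_1\cdots w_n$, $w_i=w(i)$; $s_i$ is the transposition $(i\ i+1)$; $\ell(w)$ is the Coxeter length (number of inversions); $w_0=n\,(n-1)\cdots 1$. Bumpless pipe dreams. Cells of the $n\times n$ grid are indexed $(i,j)$: row $i$ from the top, column $j$ from the left. There are six tiles: downward elbow (a pipe joining the bottom and right edges), upward elbow (a pipe joining the left and top edges), crossing (one pipe joining left and right edges and one joining bottom and top edges), blank (no pipe), horizontal (a pipe joining left and right edges), vertical (a pipe joining bottom and top edges). A bumpless pipe dream (BPD) of size $n$ is a tiling of the $n\times n$ grid by these tiles such that an edge shared by two cells is met by a pipe from both sides or from neither, every edge on the bottom boundary and every edge on the right boundary of the grid is met by a pipe, and no edge on the left or top boundary is met by a pipe. Thus there are $n$ pipes, each running from the bottom boundary to the right boundary moving north and east. $D(\mathcal P)$ is the set of positions $(i,j)$ of blank tiles of $\mathcal P$ and $U(\mathcal P)$ is the set of positions of upward elbow tiles. Demazure product $\partial(\mathcal P)\in S_n$ of a BPD $\mathcal P$: label the bottom boundary edges $1,\dots,n$ from left to right and propagate labels along pipes north and east; at a crossing tile, of the two labels entering from the left and from below, the smaller one leaves through the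 right edge and the larger one through the top edge. Then $\partial(\mathcal P)(i)$ is the label arriving at the right boundary edge of row $i$. $\mathsf{Pipes}(w)$ is the set of BPDs $\mathcal P$ of size $n$ with $\partial(\mathcal P)=w$. Weights: $x_i\oplus y_j=x_i+y_j+\beta x_iy_j$ and $$\mathrm{wt}(\mathcal P)=\Big(\prod_{(i,j)\in D(\mathcal P)}\beta(x_i\oplus y_j)\Big)\Big(\prod_{(i,j)\in U(\mathcal P)}\big(1+\beta(x_i\oplus y_j)\big)\Big).$$ $\beta$-double Grothendieck polynomials: $S_n$ acts on $\mathbb Z[\beta][y_1,\dots,y_n][x_1,\dots,x_n]$ by permuting the $x$ variables, $w\cdot f=f(x_{w_1},\dots,x_{w_n};\mathbf y)$. Let $\pi_i(f)=\dfrac{(1+\beta x_{i+1})f-(1+\beta x_i)\,s_i\cdot f}{x_i-x_{i+1}}$. Set $\mathfrak G^{(\beta)}_{w_0}(\mathbf x;\mathbf y)=\prod_{i,j\ge1,\ i+j\le n}(x_i\oplus y_j)$, and whenever $w_i>w_{i+1}$ set $\mathfrak G^{(\beta)}_{ws_i}(\mathbf x;\mathbf y)=\pi_i(\mathfrak G^{(\beta)}_w(\mathbf x;\mathbf y))$; this is well defined since the $\pi_i$ satisfy the braid and commutation relations. *)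

(* Defs.v *)
From HB Require Import structures.
From mathcomp Require Import all_boot all_order all_fingroup all_algebra.
From mathcomp Require Import ring zify.
From mathcomp Require Import boolp.
From mathcomp.multinomials Require Import mpoly.

Set Implicit Arguments.
Unset Strict Implicit.
Unset Printing Implicit Defensive.

Import GRing.Theory.
Local Open Scope ring_scope.

(* Z[beta^{±1}], realized as a subring of the fraction field of
   Z[beta] = {poly int}. *)
Section Laurent.

Local Notation K := {fraction {poly int}}.

Definition laurent_pred : {pred K} :=
  fun x => `[< exists (p : {poly int}) (k : nat),
                 x = tofrac p / tofrac ('X ^+ k) >].

Lemma tofracXn_neq0 k : tofrac ('X ^+ k : {poly int}) != 0 :> K.
Proof. by rewrite tofrac_eq0 expf_neq0 // polyX_eq0. Qed.

Lemma laurent_predP x :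
  reflect (exists (p : {poly int}) (k : nat), x = tofrac p / tofrac ('X ^+ k))
          (x \in laurent_pred).
Proof. exact: asboolP. Qed.

Lemma laurent_subring_closed : subring_closed laurent_pred.
Proof.
split.
- apply/laurent_predP; exists 1, 0; rewrite expr0 tofrac1 divr1 //.
- move=> x y /laurent_predP[p [k ->]] /laurent_predP[q [l ->]].
  apply/laurent_predP; exists (p * 'X ^+ l - q * 'X ^+ k), (k + l)%N.
  by rewrite exprD tofracB !tofracM -mulNr addf_div ?tofracXn_neq0 ?mulNr.
- move=> x y /laurent_predP[p [k ->]] /laurent_predP[q [l ->]].
  apply/laurent_predP; exists (p * q), (k + l)%N.
  by rewrite exprD !tofracM mulf_div.
Qed.

HB.instance Definition _ :=
  GRing.isSubringClosed.Build K laurent_pred laurent_subring_closed.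

Record laurent := Laurent { laurent_val : K; _ : laurent_val \in laurent_pred }.

HB.instance Definition _ := [isSub for laurent_val].
HB.instance Definition _ := [Choice of laurent by <:].
HB.instance Definition _ := [SubChoice_isSubComNzRing of laurent by <:].

Definition laurent_unit : {pred laurent} :=
  fun x => (val x != 0) && ((val x)^-1 \in laurent_pred).
Definition laurent_inv (x : laurent) : laurent :=
  if x \in laurent_unit then insubd x (val x)^-1 else x.

Fact laurent_mulV : {in laurent_unit, left_inverse 1 laurent_inv *%R}.
Proof.
move=> x ux; apply/val_inj; rewrite /laurent_inv ux rmorphM rmorph1 /=.
by case/andP: ux => x0 ix; rewrite insubdK // mulVf.
Qed.

Fact laurent_unitP (x y : laurent) : y * x = 1 -> x \in laurent_unit.
Proof.
move=> yx; have /= e: val y * val x = 1 by rewrite -rmorphM yx rmorph1.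
have x0: val x != 0.
  by apply/eqP=> x0; move/eqP: e; rewrite x0 mulr0 eq_sym oner_eq0.
apply/andP; split=> //.
have -> : (val x)^-1 = val y by apply: (mulIf x0); rewrite mulVf.
exact: valP.
Qed.

Fact laurent_inv_out : {in [predC laurent_unit], laurent_inv =1 id}.
Proof. by move=> x; rewrite inE /= /laurent_inv => /negPf ->. Qed.

HB.instance Definition _ := GRing.ComNzRing_hasMulInverse.Build laurent
  laurent_mulV laurent_unitP laurent_inv_out.

Fact laurent_of_poly_subproof (p : {poly int}) : tofrac p \in laurent_pred.
Proof. by apply/laurent_predP; exists p, 0; rewrite expr0 tofrac1 divr1. Qed.

Definition laurent_of_poly (p : {poly int}) : laurent :=
  Laurent (laurent_of_poly_subproof p).

Fact laurent_of_poly_zmod : zmod_morphism laurent_of_poly.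
Proof. by move=> p q; apply/val_inj; rewrite rmorphB /= tofracB. Qed.
Fact laurent_of_poly_monoid : monoid_morphism laurent_of_poly.
Proof.
by split=> [|p q]; apply/val_inj; rewrite ?rmorph1 ?rmorphM /= ?tofrac1 ?tofracM.
Qed.

HB.instance Definition _ :=
  GRing.isZmodMorphism.Build _ _ laurent_of_poly laurent_of_poly_zmod.
HB.instance Definition _ :=
  GRing.isMonoidMorphism.Build _ _ laurent_of_poly laurent_of_poly_monoid.

Lemma laurent_of_poly_inj : injective laurent_of_poly.
Proof. by move=> p q [/eqP]; rewrite tofrac_eq => /eqP. Qed.

Definition lbeta : laurent := laurent_of_poly 'X.

Lemma lbeta_unit : lbeta \is a GRing.unit.
Proof.
apply/andP; split; first by rewrite /= tofrac_eq0 polyX_eq0.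
by apply/laurent_predP; exists 1, 1; rewrite expr1 tofrac1 mul1r.
Qed.

End Laurent.

Fact demazure_num_split (R : comNzRingType) (t a b f f1 : R) :
  (1 + t * b) * (f - f1) - (a - b) * (t * f1) =
  (1 + t * b) * f - (1 + t * a) * f1.
Proof. by ring. Qed.

Fact rmorph_demazure_rel (R : comNzRingType) (phi : {rmorphism R -> R})
    (t a b g f f1 : R) : phi t = t ->
  (a - b) * g = (1 + t * b) * f - (1 + t * a) * f1 ->
  (phi a - phi b) * phi g =
    (1 + t * phi b) * phi f - (1 + t * phi a) * phi f1.
Proof.
move=> et /(congr1 phi).
by rewrite rmorphB !rmorphM rmorphB !rmorphD !rmorph1 !rmorphM et.
Qed.

Fact commuting_algebra (R : idomainType) (t a b c d f f1 f2 f12 p p1 q q1 r r' : R) :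
  a - b != 0 -> c - d != 0 ->
  (a - b) * r = (1 + t * b) * p - (1 + t * a) * p1 ->
  (c - d) * r' = (1 + t * d) * q - (1 + t * c) * q1 ->
  (c - d) * p = (1 + t * d) * f - (1 + t * c) * f2 ->
  (a - b) * q = (1 + t * b) * f - (1 + t * a) * f1 ->
  (c - d) * p1 = (1 + t * d) * f1 - (1 + t * c) * f12 ->
  (a - b) * q1 = (1 + t * b) * f2 - (1 + t * a) * f12 ->
  r = r'.
Proof.
move=> nab ncd er er' ep eq ep1 eq1; apply: (mulfI (mulf_neq0 nab ncd)).
transitivity ((c - d) * ((a - b) * r)); first by ring.
rewrite er.
transitivity ((1 + t * b) * ((c - d) * p) - (1 + t * a) * ((c - d) * p1)).
  by ring.
transitivity ((1 + t * d) * ((a - b) * q) - (1 + t * c) * ((a - b) * q1)).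
  by rewrite ep eq ep1 eq1; ring.
transitivity ((a - b) * ((c - d) * r')); last by ring.
by rewrite er'; ring.
Qed.

Section BraidAlgebra.
Variables (R : idomainType) (t a b c f f1 f2 f12 f21 f121 : R).
Local Notation A := (1 + t * a).
Local Notation B := (1 + t * b).
Local Notation C := (1 + t * c).
Let N := B * C ^+ 2 * f - A * C ^+ 2 * f1 - B ^+ 2 * C * f2 +
         A * B ^+ 2 * f21 + A ^+ 2 * C * f12 - A ^+ 2 * B * f121.

Fact braid_algebra_left p p1 p2 p12 q q1 r : a - b != 0 ->
  (a - b) * p = B * f - A * f1 -> (b - a) * p1 = A * f1 - B * f ->
  (a - c) * p2 = C * f2 - A * f21 -> (b - c) * p12 = C * f12 - B * f121 ->
  (b - c) * q = C * p - B * p2 -> (a - c) * q1 = C * p1 - A * p12 ->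
  (a - b) * r = B * q - A * q1 ->
  (a - b) * (a - c) * (b - c) * r = N.
Proof.
move=> nab ep ep1 ep2 ep12 eq eq1 er; apply: (mulfI nab).
transitivity ((a - b) * (a - c) * (b - c) * ((a - b) * r)); first by ring.
rewrite er.
transitivity ((a - b) * (a - c) * B * ((b - c) * q)
            - (a - b) * (b - c) * A * ((a - c) * q1)); first by ring.
rewrite eq eq1.
transitivity ((a - c) * B * C * ((a - b) * p) - (a - b) * B ^+ 2 * ((a - c) * p2)
   + (b - c) * A * C * ((b - a) * p1) + (a - b) * A ^+ 2 * ((b - c) * p12)).
  by ring.
by rewrite ep ep1 ep2 ep12 /N; ring.
Qed.

Fact braid_algebra_right p p1 p2 p21 q q2 r : b - c != 0 ->
  (b - c) * p = C * f - B * f2 -> (c - b) * p2 = B * f2 - C * f ->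
  (a - c) * p1 = C * f1 - A * f12 -> (a - b) * p21 = B * f21 - A * f121 ->
  (a - b) * q = B * p - A * p1 -> (a - c) * q2 = C * p2 - A * p21 ->
  (b - c) * r = C * q - B * q2 ->
  (a - b) * (a - c) * (b - c) * r = N.
Proof.
move=> nbc ep ep2 ep1 ep21 eq eq2 er; apply: (mulfI nbc).
transitivity ((a - b) * (a - c) * (b - c) * ((b - c) * r)); first by ring.
rewrite er.
transitivity ((b - c) * (a - c) * C * ((a - b) * q)
            - (a - b) * (b - c) * B * ((a - c) * q2)); first by ring.
rewrite eq eq2.
transitivity ((a - c) * B * C * ((b - c) * p) - (b - c) * A * C * ((a - c) * p1)
   + (a - b) * B * C * ((c - b) * p2) + (b - c) * A * B * ((a - b) * p21)).
  by ring.
by rewrite ep ep1 ep2 ep21 /N; ring.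
Qed.

End BraidAlgebra.

(* The polynomials and weights are first defined over an arbitrary coefficient
   domain A, with b in the role of beta and y j in the role of y_{j+1}; they are
   then specialized to A = Z[beta][y_1, ..., y_n]. *)
Section Grothendieck.
Variables (A : idomainType) (b : A) (n : nat) (y : 'I_n -> A).
Local Notation xpoly := {mpoly A[n]}.
Implicit Types (f g : xpoly) (i j k : 'I_n) (w u v : 'S_n).

Definition beta : xpoly := b%:MP.
Definition xvar i : xpoly := 'X_i.
Definition yvar j : xpoly := (y j)%:MP.
Definition oplus i j : xpoly :=
  xvar i + yvar j + beta * xvar i * yvar j.

Definition perm_length w : nat :=
  #|[set p : 'I_n * 'I_n | (p.1 < p.2)%N && (w p.2 < w p.1)%N]|.

Definition w0 : 'S_n := perm (@rev_ord_inj n).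

(* msym (tperm i j) exchanges x_i and x_j and fixes the y variables. *)
Definition demazure_num i j f : xpoly :=
  (1 + beta * xvar j) * f - (1 + beta * xvar i) * msym (tperm i j) f.

Lemma msym_xvar (s : 'S_n) i : msym s (xvar i) = xvar (s i).
Proof.
rewrite /xvar msymX; congr 'X_[_]; apply/mnmP=> k; rewrite mnmE !mnm1E.
by rewrite -(inj_eq (@perm_inj _ s)) permKV.
Qed.

Lemma msymC (s : 'S_n) (c : A) :
  msym s (c%:MP : xpoly) = c%:MP.
Proof. by rewrite -[c%:MP]mulr1 mul_mpolyC msymZ msym1. Qed.

Lemma sub_msym_divides i j f :
  exists g, (xvar i - xvar j) * g = f - msym (tperm i j) f.
Proof.
set s := tperm i j.
pose D h := exists g, (xvar i - xvar j) * g = h - msym s h.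
have D0 c : D c%:MP by exists 0; rewrite msymC subrr mulr0.
have DX k : D (xvar k).
  rewrite /D msym_xvar /s; case: tpermP => [->|->|_ _].
  - by exists 1; rewrite mulr1.
  - by exists (-1); rewrite mulrN1 opprB.
  - by exists 0; rewrite subrr mulr0.
have DD h1 h2 : D h1 -> D h2 -> D (h1 + h2).
  by move=> [g1 e1] [g2 e2]; exists (g1 + g2); rewrite msymD mulrDr e1 e2 addrACA opprD.
have DM h1 h2 : D h1 -> D h2 -> D (h1 * h2).
  move=> [g1 e1] [g2 e2]; exists (h1 * g2 + g1 * msym s h2).
  by rewrite msymM mulrDr mulrCA e2 mulrA e1 mulrBr mulrBl subrKA.
have DE h (k : nat) : D h -> D (h ^+ k).
  move=> Dh; elim: k => [|k IH]; last by rewrite exprS; apply: DM.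
  by rewrite expr0 -mpolyC1; apply: D0.
suff: D f by [].
rewrite [f]mpolyE; apply: (big_ind D) => [||m _].
- by rewrite -mpolyC0.
- exact: DD.
- rewrite -mul_mpolyC; apply: (DM) => //; rewrite mpolyXE_id.
  apply: (big_ind D) => [||k _]; [by rewrite -mpolyC1 | exact: DM | exact/DE/DX].
Qed.

Lemma demazure_exists i j f :
  exists g, (xvar i - xvar j) * g == demazure_num i j f.
Proof.
have [g eg] := sub_msym_divides i j f.
exists ((1 + beta * xvar j) * g - beta * msym (tperm i j) f).
rewrite mulrBr mulrCA eg /demazure_num; apply/eqP.
by rewrite demazure_num_split.
Qed.

(* The operator pi_i is demazure i j with j = i + 1: the quotient of
   demazure_num i j f by x_i - x_j. *)
Definition demazure i j f : xpoly := xchoose (demazure_exists i j f).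

Lemma demazureE i j f :
  (xvar i - xvar j) * demazure i j f = demazure_num i j f.
Proof. exact/eqP/(xchooseP (demazure_exists i j f)). Qed.

Lemma xvar_sub_neq0 i j : i != j -> xvar i - xvar j != 0.
Proof.
move=> ij; rewrite subr_eq0; apply/eqP => /(congr1 (mcoeff U_(i))).
rewrite /xvar !mcoeffX eqxx eq_mnm1 eq_sym (negPf ij) /=.
by move/eqP; rewrite oner_eq0.
Qed.

Definition groth_top : xpoly :=
  \prod_(i < n) \prod_(j < n | (i.+1 + j.+1 <= n)%N) oplus i j.

(* The product w s_i, i.e. w with the entries at positions i and i+1
   exchanged, is tperm i j * w because (s * t) x = t (s x) in MathComp. *)
Inductive is_groth : 'S_n -> xpoly -> Prop :=
| is_groth_top : is_groth w0 groth_top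
| is_groth_step w i j f : j = i.+1 :> nat -> (w j < w i)%N ->
    is_groth w f -> is_groth (tperm i j * w)%g (demazure i j f).

Let ascent u i j := (j == i.+1 :> nat) && (u i < u j)%N.

Lemma is_groth_up u i j f : j = i.+1 :> nat -> (u i < u j)%N ->
  is_groth (tperm i j * u)%g f -> is_groth u (demazure i j f).
Proof.
move=> ij uij gf.
have -> : u = (tperm i j * (tperm i j * u))%g by rewrite mulgA tperm2 mul1g.
by apply: is_groth_step; rewrite // !permM tpermL tpermR.
Qed.

Let mu u := (\sum_(i < n) i * u i)%N.

Lemma mu_up u i j : j = i.+1 :> nat -> (u i < u j)%N ->
  (mu (tperm i j * u)%g < mu u)%N.
Proof.
move=> ij uij; have nij : j != i by rewrite -val_eqE /= ij; lia.
rewrite /mu (bigD1 i) //= (bigD1 j) //= [X in (_ < X)%N](bigD1 i) //=.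
rewrite [X in (_ < _ + X)%N](bigD1 j) //= !permM tpermL tpermR.
set S := (\sum_(_ < _ | _) _)%N.
set S' := (\sum_(_ < _ | _) _)%N.
have -> : S = S'.
  apply: eq_bigr => k /andP[ki kj].
  by rewrite permM tpermD // eq_sym.
by move: S' => {}S; rewrite ij; nia.
Qed.

Lemma no_ascent_w0 u :
  (forall i j, j = i.+1 :> nat -> (u j < u i)%N) -> u = w0.
Proof.
move=> du; apply/permP=> i; apply/val_inj; rewrite permE /=.
have up m : forall k, k = m :> nat -> (u k + m < n)%N.
  elim: m => [|m IH] k km; first by rewrite addn0.
  have mn : (m < n)%N by have := ltn_ord k; lia.
  have := IH (Ordinal mn) erefl.
  by have := du (Ordinal mn) k km; lia.
have lo m : forall k, (k + m.+1 = n)%N -> (m <= u k)%N.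
  elim: m => [//|m IH] k km.
  have mn : (k.+1 < n)%N by lia.
  have := IH (Ordinal mn) => /= /(_ ltac:(lia)).
  by have := du k (Ordinal mn) erefl; lia.
have := up i i erefl; have := lo (n - i.+1)%N i.
have := ltn_ord i; lia.
Qed.

Lemma is_groth_exists u : exists f, is_groth u f.
Proof.
have [m] := ubnP (mu u); elim: m u => // m IH u; rewrite ltnS => um.
have [/existsP[i /existsP[j /andP[/eqP ij uij]]]|na] :=
  boolP [exists i, exists j, ascent u i j].
  have [f gf] := IH _ (leq_trans (mu_up ij uij) um).
  by exists (demazure i j f); apply: is_groth_up.
exists groth_top; rewrite (@no_ascent_w0 u); first exact: is_groth_top.
move=> i j ij; move: na; rewrite negb_exists => /forallP/(_ i).
rewrite negb_exists => /forallP/(_ j); rewrite /ascent ij eqxx /= -leqNgt.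
rewrite leq_eqVlt => /orP[/eqP/val_inj/perm_inj/(congr1 val) /=|//].
lia.
Qed.

Lemma is_groth_inv u f : is_groth u f ->
  (u = w0 /\ f = groth_top) \/
  (exists i j f', [/\ j = i.+1 :> nat, (u i < u j)%N,
     is_groth (tperm i j * u)%g f' & f = demazure i j f']).
Proof.
case=> [|w i j f' ij wij gf']; first by left.
right; exists i, j, f'; split=> //; first by rewrite !permM tpermL tpermR.
by rewrite mulgA tperm2 mul1g.
Qed.

Lemma msym_beta (s : 'S_n) : msym s beta = beta.
Proof. exact: msymC. Qed.

Lemma msym_demazure (s : 'S_n) i j f :
  (xvar (s i) - xvar (s j)) * msym s (demazure i j f) =
  (1 + beta * xvar (s j)) * msym s f -
  (1 + beta * xvar (s i)) * msym s (msym (tperm i j) f).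
Proof.
by rewrite -!msym_xvar (rmorph_demazure_rel (msym_beta s) (demazureE i j f)).
Qed.

Lemma tperm_commute i j k l : i != k -> i != l -> j != k -> j != l ->
  (tperm i j * tperm k l = tperm k l * tperm i j)%g.
Proof.
move=> ik il jk jl; apply/permP=> z; rewrite !permM.
have [ki li] : k != i /\ l != i by rewrite ![_ == i]eq_sym.
have [kj lj] : k != j /\ l != j by rewrite ![_ == j]eq_sym.
case: (tpermP i j z) => [->|->|/eqP zi /eqP zj].
- by rewrite [tperm k l j]tpermD 1?[tperm k l i]tpermD ?tpermL.
- by rewrite [tperm k l i]tpermD 1?[tperm k l j]tpermD ?tpermR.
- by apply/esym; case: (tpermP k l z) => [_|_|_ _]; apply: tpermD; rewrite // eq_sym.
Qed.

Lemma demazure_comm i j k l f :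
  i != j -> k != l -> i != k -> i != l -> j != k -> j != l ->
  demazure i j (demazure k l f) = demazure k l (demazure i j f).
Proof.
move=> ij kl ik il jk jl.
have nij := xvar_sub_neq0 ij; have nkl := xvar_sub_neq0 kl.
have e5 := msym_demazure (tperm i j) k l f.
have [sk sl] : tperm i j k = k /\ tperm i j l = l by rewrite !tpermD.
rewrite sk sl in e5.
have e6 := msym_demazure (tperm k l) i j f.
have [si sj] : tperm k l i = i /\ tperm k l j = j.
  by split; apply: tpermD; rewrite eq_sym.
rewrite si sj in e6.
have st : msym (tperm k l) (msym (tperm i j) f) =
          msym (tperm i j) (msym (tperm k l) f).
  by rewrite -!msymMm tperm_commute.
rewrite st in e6.
exact: (commuting_algebra nij nkl (demazureE i j _) (demazureE k l _)
          (demazureE k l f) (demazureE i j f) e5 e6).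
Qed.

Lemma tperm_braid i j k : i != j -> i != k -> j != k ->
  (tperm j k * tperm i j * tperm j k = tperm i j * tperm j k * tperm i j)%g.
Proof.
move=> ij ik jk.
have e1 : (tperm j k * tperm i j * tperm j k = tperm i k)%g.
  rewrite -{1}[tperm j k]tpermV -mulgA -/(conjg _ _) tpermJ tpermL tpermD //;
    by rewrite eq_sym.
have e2 : (tperm i j * tperm j k * tperm i j = tperm i k)%g.
  rewrite -{1}[tperm i j]tpermV -mulgA -/(conjg _ _) tpermJ tpermR tpermD //.
by rewrite e1 e2.
Qed.

Lemma demazure_braid i j k f : i != j -> i != k -> j != k ->
  demazure i j (demazure j k (demazure i j f)) =
  demazure j k (demazure i j (demazure j k f)).
Proof.
move=> ij ik jk.
have nij := xvar_sub_neq0 ij; have nik := xvar_sub_neq0 ik.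
have njk := xvar_sub_neq0 jk.
apply: (mulfI (mulf_neq0 (mulf_neq0 nij nik) njk)).
pose s1 := tperm i j; pose s2 := tperm j k.
pose f1 := msym s1 f; pose f2 := msym s2 f.
pose f12 := msym s1 f2; pose f21 := msym s2 f1; pose f121 := msym s1 f21.
have f121E : msym s2 f12 = f121.
  by rewrite /f121 /f21 /f12 /f1 /f2 -!msymMm mulgA tperm_braid // mulgA.
have s11 g : msym s1 (msym s1 g) = g by rewrite -msymMm tperm2 msym1m.
have s22 g : msym s2 (msym s2 g) = g by rewrite -msymMm tperm2 msym1m.
have s1E : (s1 i = j) * (s1 j = i) * (s1 k = k).
  by rewrite /s1 tpermL tpermR tpermD.
have s2E : (s2 i = i) * (s2 j = k) * (s2 k = j).
  by rewrite /s2 tpermL tpermR tpermD // eq_sym.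
transitivity (
  let A := 1 + beta * xvar i in let B := 1 + beta * xvar j in
  let C := 1 + beta * xvar k in
  B * C ^+ 2 * f - A * C ^+ 2 * f1 - B ^+ 2 * C * f2 +
         A * B ^+ 2 * f21 + A ^+ 2 * C * f12 - A ^+ 2 * B * f121).
- set p := demazure i j f; set q := demazure j k p.
  apply: (@braid_algebra_left _ beta _ _ _ _ _ _ _ _ _
    p (msym s1 p) (msym s2 p) (msym s1 (msym s2 p)) q (msym s1 q)) => //.
  + exact: demazureE.
  + by have := msym_demazure s1 i j f; rewrite -/s1 !s1E s11.
  + by have := msym_demazure s2 i j f; rewrite -/s1 !s2E.
  + have := msym_demazure (s2 * s1)%g i j f.
    by rewrite !permM !s2E !s1E !msymMm.
  + exact: demazureE.
  + by have := msym_demazure s1 j k p; rewrite -/s2 !s1E.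
  + exact: demazureE.
- set p := demazure j k f; set q := demazure i j p.
  apply/esym.
  apply: (@braid_algebra_right _ beta _ _ _ _ _ _ _ _ _
    p (msym s1 p) (msym s2 p) (msym s2 (msym s1 p)) q (msym s2 q)) => //.
  + exact: demazureE.
  + by have := msym_demazure s2 j k f; rewrite -/s2 !s2E s22.
  + by have := msym_demazure s1 j k f; rewrite -/s2 !s1E.
  + have := msym_demazure (s1 * s2)%g j k f.
    by rewrite !permM !s1E !s2E !msymMm -/f2 -/f12 f121E.
  + exact: demazureE.
  + by have := msym_demazure s2 i j p; rewrite -/s1 !s2E.
  + exact: demazureE.
Qed.

Lemma is_groth_unique u f g : is_groth u f -> is_groth u g -> f = g.
Proof.
have [m] := ubnP (mu u); elim: m u f g => // m IH u f g; rewrite ltnS => um.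
have w0_dec i j : j = i.+1 :> nat -> (w0 i < w0 j)%N -> False.
  by move=> ij; rewrite !permE /= ij; lia.
move=> /is_groth_inv[[-> ->]|[i [j [f' [ij uij gf' ->]]]]].
  by case/is_groth_inv=> [[_ ->]//|[i [j [? [ij /w0_dec []]]]]].
case/is_groth_inv=> [[uw _]|[k [l [g' [kl ukl gg' ->]]]]].
  by case: (w0_dec i j ij); rewrite -uw.
have muf := leq_trans (mu_up ij uij) um.
have mug := leq_trans (mu_up kl ukl) um.
have Dij : i != j by rewrite -val_eqE /= ij; lia.
have Dkl : k != l by rewrite -val_eqE /= kl; lia.
have braid (p q r : 'I_n) f1 f2 : q = p.+1 :> nat -> r = q.+1 :> nat ->
    (u p < u q)%N -> (u q < u r)%N ->
    (mu (tperm p q * u)%g < m)%N -> (mu (tperm q r * u)%g < m)%N ->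
    is_groth (tperm p q * u)%g f1 -> is_groth (tperm q r * u)%g f2 ->
    demazure p q f1 = demazure q r f2.
  move=> ab bc uab ubc m1 m2 g1 g2.
  have nab : p != q by rewrite -val_eqE /= ab; lia.
  have nac : p != r by rewrite -val_eqE /= bc ab; lia.
  have nbc : q != r by rewrite -val_eqE /= bc; lia.
  have uac := ltn_trans uab ubc.
  have [h gh] := is_groth_exists (tperm p q * tperm q r * tperm p q * u)%g.
  have s1E : (tperm p q p = q) * (tperm p q q = p) * (tperm p q r = r).
    by rewrite tpermL tpermR tpermD.
  have s2E : (tperm q r p = p) * (tperm q r q = r) * (tperm q r r = q).
    by rewrite tpermL tpermR tpermD // eq_sym.
  have -> : f1 = demazure q r (demazure p q h).
    apply: IH m1 g1 _; apply: is_groth_up => //; first by rewrite !permM !s1E.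
    apply: is_groth_up => //; first by rewrite !permM !s2E !s1E.
    by rewrite !mulgA.
  have -> : f2 = demazure p q (demazure q r h).
    apply: IH m2 g2 _; apply: is_groth_up => //; first by rewrite !permM !s2E.
    apply: is_groth_up => //; first by rewrite !permM !s1E !s2E.
    by rewrite !mulgA tperm_braid.
  exact: demazure_braid.
have [ik|ik] := eqVneq i k.
  have jl : j = l by apply/val_inj; rewrite /= ij kl ik.
  by rewrite -ik -jl in gg' *; congr demazure; apply: IH muf gf' gg'.
have [jk|jk] := eqVneq j k.
  by subst k; apply: braid uij ukl muf mug gf' gg'.
have [il|il] := eqVneq i l.
  by subst l; apply/esym; apply: braid ukl uij mug muf gg' gf'.
have jl : j != l by move: ik; rewrite -!val_eqE /= ij kl; lia.
have [h gh] := is_groth_exists (tperm k l * tperm i j * u)%g.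
have tc : (tperm i j * tperm k l = tperm k l * tperm i j)%g.
  by apply: tperm_commute; rewrite // eq_sym.
have -> : f' = demazure k l h.
  apply: IH muf gf' _; apply: is_groth_up => //; last by rewrite !mulgA.
  by rewrite !permM !tpermD // eq_sym.
have -> : g' = demazure i j h.
  apply: IH mug gg' _; apply: is_groth_up => //; last by rewrite mulgA tc.
  by rewrite !permM !tpermD // eq_sym.
exact: demazure_comm.
Qed.

Definition groth w : xpoly := sval (cid (is_groth_exists w)).

Lemma grothP w : is_groth w (groth w).
Proof. exact: svalP (cid (is_groth_exists w)). Qed.

Lemma groth_w0 : groth w0 = groth_top.
Proof. exact: is_groth_unique (grothP _) is_groth_top. Qed.

Lemma groth_step w i j : j = i.+1 :> nat -> (w j < w i)%N ->
  groth (tperm i j * w)%g = demazure i j (groth w).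
Proof.
move=> ij wij; apply: is_groth_unique (grothP _) _.
exact/is_groth_step/grothP.
Qed.

End Grothendieck.

Arguments beta {A} b n.
Arguments xvar {A n} i.


Inductive tile := DownElbow | UpElbow | Crossing | Blank | Horizontal | Vertical.

(* The edges of the cell met by a pipe, in the order left, right, top, bottom. *)
Definition ports (t : tile) : bool * bool * bool * bool :=
  match t with
  | DownElbow  => (false, true,  false, true)
  | UpElbow    => (true,  false, true,  false)
  | Crossing   => (true,  true,  true,  true)
  | Blank      => (false, false, false, false)
  | Horizontal => (true,  true,  false, false)
  | Vertical   => (false, false, true,  true)
  end.

Definition left_port t := (ports t).1.1.1.
Definition right_port t := (ports t).1.1.2.
Definition top_port t := (ports t).1.2.
Definition bottom_port t := (ports t).2.

Definition unports (p : bool * bool * bool * bool) : option tile :=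
  match p with
  | (false, true,  false, true)  => Some DownElbow
  | (true,  false, true,  false) => Some UpElbow
  | (true,  true,  true,  true)  => Some Crossing
  | (false, false, false, false) => Some Blank
  | (true,  true,  false, false) => Some Horizontal
  | (false, false, true,  true)  => Some Vertical
  | _ => None
  end.
Fact portsK : pcancel ports unports. Proof. by case. Qed.
HB.instance Definition _ := Finite.copy tile (pcan_type portsK).

Section BumplessPipeDreams.
Variable n : nat.
Implicit Types (P : 'M[tile]_n) (i j : 'I_n).

Definition is_bpd P : bool :=
  [&& [forall i : 'I_n, forall j : 'I_n, forall j' : 'I_n,
         (j' == j.+1 :> nat) ==> (right_port (P i j) == left_port (P i j'))],
      [forall i : 'I_n, forall i' : 'I_n, forall j : 'I_n,
         (i' == i.+1 :> nat) ==> (bottom_port (P i j) == top_port (P i' j))],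
      [forall i : 'I_n, forall j : 'I_n, (j == 0 :> nat)%N ==> ~~ left_port (P i j)],
      [forall i : 'I_n, forall j : 'I_n, (i == 0 :> nat)%N ==> ~~ top_port (P i j)],
      [forall i : 'I_n, forall j : 'I_n, (j.+1 == n) ==> right_port (P i j)] &
      [forall i : 'I_n, forall j : 'I_n, (i.+1 == n) ==> bottom_port (P i j)]].

(* Labels are 1, ..., n; the label of an edge met by no pipe is 0.
   pass t l b is the pair of the labels leaving t through its right and top
   edges, when l enters from the left and b from below. *)
Definition pass (t : tile) (l b : nat) : nat * nat :=
  match t with
  | DownElbow  => (b, 0)
  | UpElbow    => (0, l)
  | Crossing   => (minn l b, maxn l b)
  | Blank      => (0, 0)
  | Horizontal => (l, 0)
  | Vertical   => (0, b)
  end%N.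

Definition tile_at P (i j : nat) : tile :=
  if (insub i, insub j) is (Some i', Some j') then P i' j' else Blank.

(* The label of the left edge of column j (0-based) in a row with the given
   tiles and labels on its bottom edges; at j = n, of the right boundary. *)
Fixpoint left_label (row : nat -> tile) (bot : nat -> nat) (j : nat) : nat :=
  if j is j'.+1 then (pass (row j') (left_label row bot j') (bot j')).1 else 0%N.

(* The label of the bottom edge of column j in the r-th row from the bottom
   (0-based), i.e. in row n - r.+1 from the top. *)
Fixpoint bottom_label P (r j : nat) : nat :=
  if r is r'.+1 then
    let row := tile_at P (n - r) in
    (pass (row j) (left_label row (bottom_label P r') j) (bottom_label P r' j)).2
  else j.+1.

Definition demazure_product P : {ffun 'I_n -> nat} :=
  [ffun i : 'I_n => left_label (tile_at P i) (bottom_label P (n - i.+1)) n].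

Definition Pipes (w : 'S_n) : {set 'M[tile]_n} :=
  [set P | is_bpd P & demazure_product P == [ffun i => (w i).+1]].

Definition blanks P : {set 'I_n * 'I_n} := [set c | P c.1 c.2 == Blank].
Definition up_elbows P : {set 'I_n * 'I_n} := [set c | P c.1 c.2 == UpElbow].

Variables (A : idomainType) (b : A) (y : 'I_n -> A).

Definition wt P : {mpoly A[n]} :=
  (\prod_(c in blanks P) (beta b n * oplus b y c.1 c.2)) *
  (\prod_(c in up_elbows P) (1 + beta b n * oplus b y c.1 c.2)).

End BumplessPipeDreams.

(* The nested types are Z[beta][y_1, ..., y_n][x_1, ..., x_n] and
   Z[beta^{±1}][y_1, ..., y_n][x_1, ..., x_n]. *)
Notation xypoly n := {mpoly {mpoly {poly int}[n]}[n]}.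
Notation xylaurent n := {mpoly {mpoly laurent[n]}[n]}.

Definition grothendieck n (w : 'S_n) : xypoly n :=
  groth ('X%:MP) (fun j => 'X_j) w.

Definition pipe_weight n (P : 'M[tile]_n) : xypoly n :=
  wt ('X%:MP) (fun j => 'X_j) P.

Definition to_laurent n : xypoly n -> xylaurent n :=
  map_mpoly (map_mpoly laurent_of_poly).

(* Main.v *)
(** Write [X_i = 1 + beta x_i] and [Y_j = 1 + beta y_j], so that a blank tile has
    weight [X_i Y_j - 1] and an upward elbow [X_i Y_j]. A bumpless pipe dream
    with propagated labels is then a state of a solvable colored lattice model
    whose row parameters are the [X_i]. Its partition functions
    [Z_w = \sum_(P in Pipes w) wt P] are compared with [beta ^ l(w) G_w].
    Attaching an R-matrix to rows [i] and [i+1] at the left boundary, where no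
    pipe enters, and moving it to the right boundary by the Yang-Baxter equation
    gives, for [w_i > w_(i+1)],
      [X_i s_i(Z_w) = X_(i+1) Z_w - (X_i - X_(i+1)) Z_(w s_i)],
    which is the recursion defining [beta ^ l(w) G_w]. For [w = w_0] the
    labels force every row, and a single pipe dream remains. *)

Require Import Defs.
From mathcomp Require Import all_boot all_fingroup all_algebra.
From mathcomp Require Import ring zify.
From mathcomp.multinomials Require Import mpoly.

Set Implicit Arguments.
Unset Strict Implicit.
Unset Printing Implicit Defensive.

Import GRing.Theory.
Local Open Scope ring_scope.

(** * Local vertices, row transfer and the Yang-Baxter equation *)

Local Notation nz := (filter (fun l : nat => l != 0%N)).

(** Conservation of pipes, in a form that [lia] can chain: one linear equation between counts for
    each predicate. *)
Lemma nz_permP s t :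
  (forall P, count (predI P (predC1 0%N)) s = count (predI P (predC1 0%N)) t) <->
  perm_eq (nz s) (nz t).
Proof.
split=> [e|/seq.permP e P]; first by apply/seq.permP => P; rewrite !count_filter e.
by have := e P; rewrite !count_filter.
Qed.

Section Lattice.
Variable R : comNzRingType.
Implicit Types (x y a b : R) (ys : seq R) (l r c t : nat) (bs ts : seq nat).

(* Linear combinations of outcomes are encoded by continuations: [vertex x y l c g]
   is the sum, over the tiles that labels [l] (left) and [c] (bottom) can enter,
   of the weight of the tile times [g] at its right and top labels. *)
Definition vertex x y l c (g : nat -> nat -> R) : R :=
  if l == 0%N then
    if c == 0%N then (x * y - 1) * g 0%N 0%N else g c 0%N + g 0%N c
  else if c == 0%N then g l 0%N + x * y * g 0%N l
  else g (minn l c) (maxn l c).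

(* The label 0 (no pipe) plays the role of the largest label; [l] is the label in
   the lower row and [l'] the one in the upper row. *)
Definition rmatrix a b l l' (g : nat -> nat -> R) : R :=
  if l == l' then a * g l l'
  else if (l != 0%N) && ((l' == 0%N) || (l < l')%N) then b * g l l'
  else a * g l l' + (b - a) * g l' l.

Lemma eq_vertex x y l c g g' :
  (forall r t, perm_eq (nz [:: r; t]) (nz [:: l; c]) -> g r t = g' r t) ->
  vertex x y l c g = vertex x y l c g'.
Proof.
move=> e; rewrite /vertex.
case: (eqVneq l 0%N) => [->|l0] in e *; case: (eqVneq c 0%N) => [->|c0] in e *.
- by rewrite e.
- by rewrite !e //= c0.
- by rewrite !e //= l0.
- rewrite e //; rewrite /minn /maxn; case: ifP => // _.
  exact: (perm_filter _ (permEl (perm_catC [:: c] [:: l]))).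
Qed.

(** Both sides depend on the labels only through which of them vanish and how they compare, so
    finitely many polynomial identities remain. *)
Lemma yang_baxter a b y l l' c (g : nat -> nat -> nat -> R) :
  uniq (nz [:: l; l'; c]) ->
  rmatrix a b l l'
    (fun m m' => vertex a y m c (fun r t => vertex b y m' t (g r))) =
  vertex b y l c (fun r t => vertex a y l' t
    (fun r' t' => rmatrix a b r r' (fun m m' => g m m' t'))).
Proof.
move=> U.
have {U} [ll [lc lc']] : (l = 0 \/ l <> l')%N /\ (l = 0 \/ l <> c)%N /\ (l' = 0 \/ l' <> c)%N.
  by move: U => /=; do 3?[case: eqVneq => ? /=]; rewrite ?inE; lia.
rewrite /rmatrix /vertex /minn /maxn.
(* Tests free of nested conditionals are split first; label orders that contradict each other are
   discarded at once. *)
repeat match goal with |- context [if ?B then _ else _] =>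
  lazymatch B with context [if _ then _ else _] => fail | _ =>
   let H := fresh in case H : B; try (exfalso; lia) end end; try ring.
Qed.

(** The row transfer matrix in continuation form: [k] receives the labels on the top edges and the
    label leaving at the right. *)
Fixpoint transfer x ys bs l (k : seq nat -> nat -> R) : R :=
  match ys, bs with
  | y :: ys', c :: bs' =>
      vertex x y l c (fun r t => transfer x ys' bs' r (fun top => k (t :: top)))
  | _, _ => k [::] l
  end.

(** Two rows, [a] below [b], evaluated column by column so that the Yang-Baxter equation can act on
    one column at a time. *)
Fixpoint transfer2 a b ys bs l l' (k : seq nat -> nat -> nat -> R) : R :=
  match ys, bs with
  | y :: ys', c :: bs' =>
      vertex a y l c (fun r t => vertex b y l' t (fun r' t' =>
        transfer2 a b ys' bs' r r' (fun top => k (t' :: top))))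
  | _, _ => k [::] l l'
  end.

Lemma eq_transfer x ys bs l k k' : size ys = size bs ->
  (forall top r, size top = size bs ->
     perm_eq (nz (r :: top)) (nz (l :: bs)) -> k top r = k' top r) ->
  transfer x ys bs l k = transfer x ys bs l k'.
Proof.
elim: ys bs l k k' => [|y ys IH] [|c bs] l k k' // => [_ e|[sz] e].
  by apply: e.
rewrite [LHS]/= [RHS]/=; apply: eq_vertex => r t p; apply: IH => // top r' st p'; apply: e.
  by rewrite /= st.
by apply/nz_permP => P; have /= := (nz_permP _ _).2 p P; have /= := (nz_permP _ _).2 p' P; lia.
Qed.

Lemma vertexD x y l c g h :
  vertex x y l c (fun r t => g r t + h r t) = vertex x y l c g + vertex x y l c h.
Proof. by rewrite /vertex; do 2?case: ifP => _ //; ring. Qed.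

Lemma vertexZ x y l c z g :
  vertex x y l c (fun r t => z * g r t) = z * vertex x y l c g.
Proof. by rewrite /vertex; do 2?case: ifP => _ //; ring. Qed.

Lemma vertex_ext x y l c g h : (forall r t, g r t = h r t) ->
  vertex x y l c g = vertex x y l c h.
Proof. by move=> e; apply: eq_vertex. Qed.

Lemma transfer_ext x ys bs l k k' : (forall top r, k top r = k' top r) ->
  transfer x ys bs l k = transfer x ys bs l k'.
Proof.
elim: ys bs l k k' => [|y ys IH] [|c bs] l k k' //= e.
by apply: vertex_ext => r t; apply: IH.
Qed.

Lemma transferD x ys bs l g h :
  transfer x ys bs l (fun top r => g top r + h top r) =
  transfer x ys bs l g + transfer x ys bs l h.
Proof.
elim: ys bs l g h => [|y ys IH] [|c bs] l g h //=.
by rewrite -vertexD; apply: vertex_ext => r t; rewrite IH.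
Qed.

Lemma transferZ x ys bs l z g :
  transfer x ys bs l (fun top r => z * g top r) = z * transfer x ys bs l g.
Proof.
elim: ys bs l g => [|y ys IH] [|c bs] l g //=.
by rewrite -vertexZ; apply: vertex_ext => r t; rewrite IH.
Qed.

Lemma transfer_vertex x a y ys bs l l' c (k : nat -> nat -> seq nat -> nat -> R) :
  transfer x ys bs l (fun top r => vertex a y l' c (fun r' t' => k r' t' top r)) =
  vertex a y l' c (fun r' t' => transfer x ys bs l (k r' t')).
Proof. by rewrite /vertex; do 2?case: ifP => _; rewrite ?transferD ?transferZ. Qed.

(** By linearity ([transfer_vertex]), the first vertex of the upper row commutes with the remaining
    columns of the lower row. *)
Lemma transfer_transfer a b ys bs l l' k :
  transfer a ys bs l (fun top r => transfer b ys top l' (fun top' r' => k top' r r')) =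
  transfer2 a b ys bs l l' k.
Proof.
elim: ys bs l l' k => [|y ys IH] [|c bs] l l' k //=.
apply: vertex_ext => r t.
rewrite transfer_vertex; apply: vertex_ext => r' t'.
exact: IH.
Qed.

(** The train argument: the R-matrix passes one column at a time, and conservation of pipes keeps
    the nonzero labels distinct. *)
Lemma transfer2_yang_baxter a b ys bs l l' k : size ys = size bs ->
  uniq (nz [:: l, l' & bs]) ->
  rmatrix a b l l' (fun m m' => transfer2 a b ys bs m m' k) =
  transfer2 b a ys bs l l' (fun top r r' => rmatrix a b r r' (k top)).
Proof.
elim: ys bs l l' k => [|y ys IH] [|c bs] l l' k // [sz] U.
rewrite [LHS]/= [RHS]/=.
rewrite (@yang_baxter a b y l l' c (fun r r' t' =>
  transfer2 a b ys bs r r' (fun top => k (t' :: top)))); last first.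
  by move: U; rewrite -[[:: l, l', c & bs]]/([:: l; l'; c] ++ bs) filter_cat cat_uniq => /and3P[].
apply: eq_vertex => r t p1; apply: eq_vertex => r' t' p2.
apply: IH => //.
(* The pipe leaving through the top, if any, and those still to be processed are together the
   original ones. *)
have p : perm_eq (nz [:: t', r, r' & bs]) (nz [:: l, l', c & bs]).
  by apply/nz_permP => P; have /= := (nz_permP _ _).2 p1 P; have /= := (nz_permP _ _).2 p2 P; lia.
move: U; rewrite -(perm_uniq p); apply: subseq_uniq.
by rewrite [X in subseq _ X]/=; case: ifP => _ //; apply: subseq_cons.
Qed.
End Lattice.

(** * Partition functions, exchange of row parameters and frozen states *)

Section Partition.
Variable R : comNzRingType.
Implicit Types (x y a b : R) (ys : seq R) (l r c t : nat) (bs ts : seq nat).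
Implicit Type rows : seq (R * nat).

(* Rows are listed from bottom to top, each with its required right label. *)
Fixpoint lattice_sum rows ys bs : R :=
  match rows with
  | (x, w) :: rows' =>
      transfer x ys bs 0 (fun top r => (r == w)%:R * lattice_sum rows' ys top)
  | [::] => (all (pred1 0%N) bs)%:R
  end.

(** At the left boundary, where both labels are 0, the R-matrix is the scalar [a]. At the right
    boundary two outcomes contribute: [q] below [p] with coefficient [b], and [p] below [q] with
    coefficient [b - a]. *)
Lemma lattice_sum_exchange a b p q pre post ys bs :
  size ys = size bs -> uniq (nz bs) -> (0 < q < p)%N ->
  a * lattice_sum (pre ++ (a, q) :: (b, p) :: post) ys bs =
  b * lattice_sum (pre ++ (b, q) :: (a, p) :: post) ys bs -
  (a - b) * lattice_sum (pre ++ (b, p) :: (a, q) :: post) ys bs.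
Proof.
move=> sz U qp; elim: pre bs sz U => [|[x w] pre IH] bs sz U.
  pose k r r' : seq nat -> R := fun top =>
    (r == q)%:R * ((r' == p)%:R * lattice_sum post ys top).
  have E (c d : R) u v : lattice_sum ((c, u) :: (d, v) :: post) ys bs =
      transfer2 c d ys bs 0 0 (fun top r r' =>
        (r == u)%:R * ((r' == v)%:R * lattice_sum post ys top)).
    by rewrite -transfer_transfer /=; apply: transfer_ext => top r; rewrite transferZ.
  have := transfer2_yang_baxter a b (fun top r r' => k r r' top) sz (l := 0) (l' := 0) U.
  rewrite {1}/rmatrix eqxx !cat0s !E => ->.
  rewrite -mulNr opprB -!transfer_transfer -!transferZ -transferD.
  apply: transfer_ext => top r; rewrite -!transferZ -transferD.
  apply: transfer_ext => top' r'; rewrite /rmatrix /k /=.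
  have [rq|rq] := eqVneq r q; have [rp|rp] := eqVneq r p;
  have [rq'|rq'] := eqVneq r' q; have [rp'|rp'] := eqVneq r' p;
    try (exfalso; lia); repeat (case: ifP => ?); try (exfalso; lia); rewrite /=; ring.
(* Rows of [pre] lie below the exchanged pair and act linearly; [eq_transfer] supplies the distinct
   labels that the induction hypothesis asks for. *)
rewrite /= -mulNr -!transferZ -transferD; apply: eq_transfer => // top r st p'.
have {}IH := IH top.
rewrite mulrCA IH ?st //; first by ring.
have: uniq (nz (r :: top)) by rewrite (perm_uniq p').
by apply: subseq_uniq; rewrite [X in subseq _ X]/=; case: ifP => // _; apply: subseq_cons.
Qed.

(* A nonzero right label of a row entered it from the left or from below. *)
Lemma transfer_avoid x ys bs l w (k : seq nat -> R) : size ys = size bs ->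
  w != 0%N -> w \notin l :: bs ->
  transfer x ys bs l (fun top r => (r == w)%:R * k top) = 0.
Proof.
move=> sz w0 wN; rewrite (@eq_transfer _ _ _ _ _ _ (fun _ _ => 0 * 0)) ?transferZ ?mul0r //
  => top r _ p.
have [rw|_] := eqVneq r w; last by rewrite !mul0r.
have := perm_mem p w; rewrite rw !mem_filter w0 /= inE eqxx => /esym.
by rewrite (negPf wN).
Qed.

(** At each crossing the smaller label continues to the right, and [l] is smaller than every label
    below it. *)
Lemma transfer_crossings x ys l m k : size ys = m -> l != 0%N ->
  transfer x ys (iota l.+1 m) l k = k (iota l.+1 m) l.
Proof.
move=> sz l0.
suff H v : (l < v)%N -> transfer x ys (iota v m) l k = k (iota v m) l by exact: H.
elim: m v ys sz k => [|m IH] v [|y ys] //= [sz] k lv.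
rewrite /vertex (negPf l0).
have -> : (v == 0%N) = false by lia.
by rewrite (minn_idPl (ltnW lv)) (maxn_idPr (ltnW lv)) IH // ltnW.
Qed.

(** The first [k] tiles are blank. In the next column [v] must turn right: going straight up, it
    would never reach the right boundary. It then crosses all later pipes, which are larger. *)
Lemma transfer_frozen x ys k v m (K : seq nat -> R) : size ys = (k + m.+1)%N ->
  v != 0%N ->
  transfer x ys (nseq k 0%N ++ iota v m.+1) 0 (fun top r => (r == v)%:R * K top) =
  \prod_(y <- take k ys) (x * y - 1) * K (nseq k.+1 0%N ++ iota v.+1 m).
Proof.
move=> sz v0; elim: k ys K sz => [|k IH] [|y ys] K //= [sz].
  rewrite big_nil mul1r /vertex /= (negPf v0) transfer_crossings // eqxx mul1r.
  rewrite transfer_avoid ?addr0 ?size_iota // inE negb_or v0 mem_iota.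
  by lia.
by rewrite big_cons -mulrA /vertex /= (IH _ (fun top => K (0%N :: top))).
Qed.
End Partition.

Lemma rmorph_transfer (R S : comNzRingType) (f : {rmorphism R -> S}) x ys bs l k k' :
  (forall top r, f (k top r) = k' top r) ->
  f (transfer x ys bs l k) = transfer (f x) (map f ys) bs l k'.
Proof.
elim: ys bs l k k' => [|y ys IH] [|c bs] l k k' //= e.
have {}IH l' t : f (transfer x ys bs l' (fun top => k (t :: top))) =
    transfer (f x) (map f ys) bs l' (fun top => k' (t :: top)).
  exact: IH.
by rewrite /vertex; do 2?case: ifP => _;
  rewrite ?rmorphD ?rmorphM ?rmorphB ?rmorphM ?rmorph1 /= !IH.
Qed.

(** With [f] an exchange of two x variables, the action on polynomials becomes an exchange of row
    parameters. *)
Lemma rmorph_lattice_sum (R S : comNzRingType) (f : {rmorphism R -> S}) rows ys bs :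
  f (lattice_sum rows ys bs) =
  lattice_sum [seq (f u.1, u.2) | u <- rows] (map f ys) bs.
Proof.
elim: rows bs => [|[x w] rows IH] bs /=; first by rewrite rmorph_nat.
by apply: rmorph_transfer => top r; rewrite rmorphM rmorph_nat IH.
Qed.

(** Each row removes the smallest remaining label, so the next one starts with one more empty column
    and [transfer_frozen] applies again. *)
Lemma lattice_sum_frozen (R : comNzRingType) (xs ys : seq R) k m :
  size xs = m -> size ys = (k + m)%N ->
  lattice_sum (zip xs (iota k.+1 m)) ys (nseq k 0%N ++ iota k.+1 m) =
  \prod_(i < m) \prod_(y <- take (k + i) ys) (nth 0 xs i * y - 1).
Proof.
elim: m k xs => [|m IH] k [|x xs] //.
  by rewrite big_ord0 cats0 => _ _; rewrite /= all_nseq orbT.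
move=> [sx] sy; rewrite big_ord_recl [LHS]/=.
rewrite (transfer_frozen x (lattice_sum _ ys)) //.
rewrite (IH k.+1) ?sx ?sy ?addnS // /= addn0; congr (_ * _).
by apply: eq_bigr => i _; rewrite addSnnS.
Qed.

(** * Lattice sums as sums over tilings *)

Section BigTuple.
Variables (R : nmodType) (T : finType).

Lemma big_tuple_cons m (F : m.+1.-tuple T -> R) :
  \sum_t F t = \sum_x \sum_(t : m.-tuple T) F [tuple of x :: t].
Proof.
rewrite pair_big /= (reindex (fun u : T * m.-tuple T => [tuple of u.1 :: u.2])) //=.
exists (fun t => (thead t, [tuple of behead t])) => [[x t] _|t _] /=.
  by congr pair; apply: val_inj.
by rewrite -tuple_eta.
Qed.

Lemma big_tuple_nil (F : 0.-tuple T -> R) : \sum_t F t = F [tuple].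
Proof. by rewrite (big_pred1 [tuple]) // => t; apply/esym/eqP/val_inj; case: t => -[]. Qed.

End BigTuple.

Section Tilings.
Variable R : comNzRingType.
Implicit Types (x y a b : R) (ys : seq R) (l r c : nat) (bs : seq nat) (t : tile) (ts : seq tile).
Implicit Type rows : seq (R * nat).

Definition fits t l c := (left_port t == (l != 0%N)) && (bottom_port t == (c != 0%N)).

Definition tile_weight x y t : R :=
  match t with Blank => x * y - 1 | UpElbow => x * y | _ => 1 end.

Lemma big_tile (F : tile -> R) : \sum_t F t =
  F DownElbow + F UpElbow + F Crossing + F Blank + F Horizontal + F Vertical.
Proof.
have p : perm_eq (index_enum tile)
    [:: DownElbow; UpElbow; Crossing; Blank; Horizontal; Vertical].
  apply: uniq_perm; rewrite ?index_enum_uniq //.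
  by move=> t; rewrite mem_index_enum; case: t.
by rewrite (perm_big _ p) !big_cons big_nil /= addr0 !addrA.
Qed.

(** Tiles that do not fit get a factor 0, so the sum can run over all tiles and, later, over all
    matrices of tiles. *)
Lemma vertexE x y l c g : vertex x y l c g =
  \sum_t (fits t l c)%:R * tile_weight x y t * g (pass t l c).1 (pass t l c).2.
Proof.
rewrite big_tile /vertex /fits /= /left_port /bottom_port /=.
by case: eqP => [->|_]; case: eqP => [->|_] /=; ring.
Qed.

Fixpoint row_weight x ys bs ts l : R :=
  match ys, bs, ts with
  | y :: ys', c :: bs', t :: ts' =>
      (fits t l c)%:R * tile_weight x y t * row_weight x ys' bs' ts' (pass t l c).1
  | _, _, _ => 1
  end.

Fixpoint row_right bs ts l : nat :=
  match bs, ts with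
  | c :: bs', t :: ts' => row_right bs' ts' (pass t l c).1
  | _, _ => l
  end.

Fixpoint row_top bs ts l : seq nat :=
  match bs, ts with
  | c :: bs', t :: ts' => (pass t l c).2 :: row_top bs' ts' (pass t l c).1
  | _, _ => [::]
  end.

Lemma transferE m x ys bs l k : size ys = m -> size bs = m ->
  transfer x ys bs l k = \sum_(ts : m.-tuple tile)
    row_weight x ys bs ts l * k (row_top bs ts l) (row_right bs ts l).
Proof.
elim: m ys bs l k => [|m IH] [|y ys] [|c bs] l k //=.
  by rewrite big_tuple_nil mul1r.
move=> [sy] [sb]; rewrite vertexE big_tuple_cons; apply: eq_bigr => t _.
rewrite IH // mulr_sumr; apply: eq_bigr => ts _ /=.
by rewrite mulrA.
Qed.

Fixpoint tiling_weight rows ys bs (tss : seq (seq tile)) : R :=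
  match rows, tss with
  | (x, w) :: rows', ts :: tss' =>
      row_weight x ys bs ts 0 * (row_right bs ts 0 == w)%:R *
      tiling_weight rows' ys (row_top bs ts 0) tss'
  | _, _ => (all (pred1 0%N) bs)%:R
  end.

Lemma size_row_top bs ts l : size bs = size ts -> size (row_top bs ts l) = size bs.
Proof. by elim: bs ts l => [|c bs IH] [|t ts] l //= [s]; rewrite IH. Qed.

Lemma lattice_sumE h m rows ys bs : size rows = h -> size ys = m -> size bs = m ->
  lattice_sum rows ys bs = \sum_(tss : h.-tuple (m.-tuple tile))
    tiling_weight rows ys bs (map (@tval m _) tss).
Proof.
elim: h rows bs => [|h IH] [|[x w] rows] bs //=; first by rewrite big_tuple_nil.
move=> [sr] sy sb; rewrite (transferE _ _ _ sy sb) big_tuple_cons.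
apply: eq_bigr => ts _; rewrite IH //; last by rewrite size_row_top ?size_tuple.
by rewrite !mulr_sumr; apply: eq_bigr => tss _ /=; rewrite mulrA.
Qed.

End Tilings.

(** Generalizes [left_label] to an arbitrary entering label, so that a row can also be taken apart
    from its left end. *)
Fixpoint label_from (l : nat) (row : nat -> tile) (bot : nat -> nat) (j : nat) : nat :=
  if j is j'.+1 then (pass (row j') (label_from l row bot j') (bot j')).1 else l.

Lemma left_labelE row bot j : left_label row bot j = label_from 0 row bot j.
Proof. by elim: j => //= j ->. Qed.

Lemma label_fromS l row bot j : label_from l row bot j.+1 =
  label_from (pass (row 0%N) l (bot 0%N)).1 (row \o succn) (bot \o succn) j.
Proof. by elim: j => //= j ->. Qed.

Lemma eq_left_label row row' bot bot' j :
  (forall k, (k < j)%N -> row k = row' k) -> (forall k, (k < j)%N -> bot k = bot' k) ->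
  left_label row bot j = left_label row' bot' j.
Proof.
elim: j => //= j IH e e'; rewrite e // e' // IH // => k kj; [apply: e|apply: e'];
  exact: ltnW.
Qed.

Section Rows.
Variable R : comNzRingType.
Implicit Types (ys : seq R) (bs : seq nat) (ts : seq tile).

Lemma row_rightE bs ts l : size bs = size ts ->
  row_right bs ts l = label_from l (nth Blank ts) (nth 0%N bs) (size ts).
Proof.
by elim: bs ts l => [|c bs IH] [|t ts] l // [s]; rewrite [size _]/= label_fromS /= IH.
Qed.

Lemma nth_row_top bs ts l j : size bs = size ts -> (j < size ts)%N ->
  nth 0%N (row_top bs ts l) j =
  (pass (nth Blank ts j) (label_from l (nth Blank ts) (nth 0%N bs) j) (nth 0%N bs j)).2.
Proof.
elim: bs ts l j => [|c bs IH] [|t ts] l [|j] // [s] lt.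
by rewrite label_fromS /= IH.
Qed.

Lemma row_weightE x ys bs ts l m : size ys = m -> size bs = m -> size ts = m ->
  row_weight x ys bs ts l = \prod_(j < m)
    ((fits (nth Blank ts j) (label_from l (nth Blank ts) (nth 0%N bs) j) (nth 0%N bs j))%:R
      * tile_weight x (nth 0 ys j) (nth Blank ts j)).
Proof.
elim: m ys bs ts l => [|m IH] [|y ys] [|c bs] [|t ts] l //; first by rewrite big_ord0.
move=> [sy] [sb] [st]; rewrite big_ord_recl [LHS]/= IH //; congr (_ * _).
by apply: eq_bigr => j _; rewrite lift0 label_fromS.
Qed.

(** [bl k] stands for the labels below the row of index [k] from the bottom; it is kept abstract so
    that [bottom_label] can be substituted. *)
Lemma tiling_weightE n (rows : seq (R * nat)) ys (bl : nat -> seq nat) (tss : seq (seq tile)) :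
  size rows = n -> size tss = n ->
  (forall k, (k < n)%N -> row_top (bl k) (nth [::] tss k) 0 = bl k.+1) ->
  tiling_weight rows ys (bl 0%N) tss = \prod_(k < n)
    (row_weight (nth (0, 0%N) rows k).1 ys (bl k) (nth [::] tss k) 0 *
     (row_right (bl k) (nth [::] tss k) 0 == (nth (0, 0%N) rows k).2)%:R)
  * (all (pred1 0%N) (bl n))%:R.
Proof.
elim: n rows tss bl => [|n IH] [|[x w] rows] [|ts tss] bl //.
  by rewrite big_ord0 mul1r.
move=> [sr] [st] e; rewrite big_ord_recl [LHS]/= -[RHS]mulrA; congr (_ * _).
have /= -> := e 0%N (ltn0Sn n); rewrite (IH _ _ (fun k => bl k.+1)) // => k kn.
exact: (e k.+1).
Qed.

Lemma prodr_bool (I : finType) (b : I -> bool) :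
  \prod_(i : I) (b i)%:R = ([forall i, b i])%:R :> R.
Proof.
case: forallP => [H|/forallP]; first by rewrite big1 // => i _; rewrite H.
by rewrite negb_forall => /existsP[i /negPf bi]; rewrite (bigD1 i) //= bi mul0r.
Qed.

End Rows.

(** * Tilings as matrices *)

Section Matrix.
Variable n : nat.
Implicit Types (P : 'M[tile]_n) (i j : 'I_n) (v : 'I_n -> nat).

Definition in_left P i (j : nat) := left_label (tile_at P i) (bottom_label P (n - i.+1)) j.
Definition in_bottom P i (j : nat) := bottom_label P (n - i.+1) j.

(** Collects the 0/1 factors of [tiling_weight]: compatible tiles, prescribed right labels, no pipe
    through the top boundary. *)
Definition labelled v P : bool :=
  [&& [forall i : 'I_n, [forall j : 'I_n, fits (P i j) (in_left P i j) (in_bottom P i j)]],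
      [forall i : 'I_n, in_left P i n == v i] & [forall j : 'I_n, bottom_label P n j == 0%N]].

(* Row [r] from the bottom is row [rev_ord r] from the top. *)
Definition tile_rows P : n.-tuple (n.-tuple tile) :=
  [tuple [tuple P (rev_ord r) j | j < n] | r < n].

Lemma tile_rows_bij : bijective tile_rows.
Proof.
exists (fun tss => \matrix_(i, j) tnth (tnth tss (rev_ord i)) j) => [P|tss].
  by apply/matrixP => i j; rewrite mxE !tnth_mktuple rev_ordK.
apply: eq_from_tnth => r; apply: eq_from_tnth => j.
by rewrite !tnth_mktuple mxE rev_ordK.
Qed.

Lemma tile_atE P i j : tile_at P i j = P i j.
Proof. by rewrite /tile_at !valK. Qed.

Lemma nth_tile_rows P i (j : nat) : (j < n)%N ->
  nth Blank (nth [::] (map (@tval n _) (tile_rows P)) (rev_ord i)) j = tile_at P i j.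
Proof.
move=> jn; rewrite (nth_map [tuple of nseq n Blank]) ?size_tuple ?ltn_ord //.
rewrite nth_mktuple rev_ordK -[j]/(val (Ordinal jn)).
by rewrite nth_mktuple tile_atE.
Qed.

Variable R : comNzRingType.
Implicit Types (X Y : 'I_n -> R).

Lemma tiling_weight_matrix X Y v P :
  tiling_weight [seq (X (rev_ord r), v (rev_ord r)) | r <- enum 'I_n]
    [seq Y j | j <- enum 'I_n] (iota 1 n) (map (@tval n _) (tile_rows P)) =
  (labelled v P)%:R * \prod_(i < n) \prod_(j < n) tile_weight (X i) (Y j) (P i j).
Proof.
pose bl k := mkseq (bottom_label P k) n.
have -> : iota 1 n = bl 0%N by rewrite /bl /mkseq -[1%N]/(1 + 0)%N iotaDl.
have szr i : size (nth [::] (map (@tval n _) (tile_rows P)) (rev_ord i)) = n.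
  by rewrite (nth_map [tuple of nseq n Blank]) ?size_tuple ?ltn_ord.
have leftE i (j : nat) : (j <= n)%N ->
    label_from 0 (nth Blank (nth [::] (map (@tval n _) (tile_rows P)) (rev_ord i)))
      (nth 0%N (bl (rev_ord i))) j = in_left P i j.
  move=> jn; rewrite -left_labelE; apply: eq_left_label => k kj.
    by rewrite nth_tile_rows // (leq_trans kj).
  by rewrite nth_mkseq // (leq_trans kj).
rewrite (@tiling_weightE _ n); last first.
- move=> k kn; have [i -> {k kn}] : exists i : 'I_n, k = rev_ord i.
    by exists (rev_ord (Ordinal kn)); rewrite rev_ordK.
  apply: (@eq_from_nth _ 0%N); first by rewrite size_row_top ?szr ?size_mkseq.
  rewrite size_row_top ?szr ?size_mkseq // => j jn.
  rewrite nth_row_top ?szr ?size_mkseq // leftE 1?ltnW // nth_tile_rows // !nth_mkseq //.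
  (* Row [r] from the bottom is row [n - r.+1] from the top, here with [r = n - i.+1]. *)
  have e : (n - (n - i.+1).+1)%N = i by have := ltn_ord i; lia.
  by rewrite /= e.
- by rewrite size_map size_tuple.
- by rewrite size_map size_enum_ord.
rewrite (reindex_inj rev_ord_inj).
transitivity (\prod_(i < n) ((\prod_(j < n)
    ((fits (P i j) (in_left P i j) (in_bottom P i j))%:R *
      tile_weight (X i) (Y j) (P i j))) * (in_left P i n == v i)%:R)
    * (all (pred1 0%N) (bl n))%:R : R).
  congr (_ * _); apply: eq_bigr => i _.
  have rowE : nth (0, 0%N) [seq (X (rev_ord r), v (rev_ord r)) | r <- enum 'I_n]
      (rev_ord i) = (X i, v i).
    by rewrite (nth_map i) ?size_enum_ord ?ltn_ord // nth_ord_enum rev_ordK.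
  rewrite rowE ![fst _]/= ![snd _]/= (@row_weightE _ _ _ _ _ _ n) ?size_mkseq ?szr //; last first.
    by rewrite size_map size_enum_ord.
  rewrite row_rightE ?size_mkseq ?szr // leftE //; congr (_ * _).
  apply: eq_bigr => j _; rewrite leftE 1?ltnW // nth_tile_rows // tile_atE.
  by rewrite nth_mkseq // (nth_map i) ?size_enum_ord // nth_ord_enum.
rewrite big_split /= prodr_bool.
under eq_bigr do rewrite big_split /= prodr_bool.
rewrite big_split /= prodr_bool /labelled -!mulnb !natrM.
have -> : all (pred1 0%N) (bl n) = [forall j : 'I_n, bottom_label P n j == 0%N].
  apply/allP/forallP => [H j|H c /mapP[j]].
    by apply: H; apply/map_f; rewrite mem_iota /=.
  by rewrite mem_iota => /= jn ->; exact: (H (Ordinal jn)).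
by ring.
Qed.

End Matrix.

(** * Labelled matrices and bumpless pipe dreams *)

Lemma fits_right t l c : fits t l c -> right_port t = ((pass t l c).1 != 0%N).
Proof.
rewrite /fits; case: t; case: l => [|l]; case: c => [|c] //= _.
by rewrite minnSS.
Qed.

Lemma fits_top t l c : fits t l c -> top_port t = ((pass t l c).2 != 0%N).
Proof.
rewrite /fits; case: t; case: l => [|l]; case: c => [|c] //= _.
by rewrite maxnSS.
Qed.

Section Labelled.
Variable n : nat.
Implicit Types (P : 'M[tile]_n) (i j : 'I_n) (v : 'I_n -> nat).

Lemma in_leftS P i j :
  in_left P i j.+1 = (pass (P i j) (in_left P i j) (in_bottom P i j)).1.
Proof. by rewrite /in_left /= tile_atE. Qed.

(** Rows [i] and below number [n - i], so these labels sit on the top edges of row [i]. *)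
Lemma bottom_label_above P i j :
  bottom_label P (n - i) j = (pass (P i j) (in_left P i j) (in_bottom P i j)).2.
Proof.
have e : (n - i = (n - i.+1).+1)%N by have := ltn_ord i; lia.
rewrite e /= -e; have -> : (n - (n - i) = i)%N by have := ltn_ord i; lia.
by rewrite tile_atE.
Qed.

(** Adjacent cells read the same label on their common edge, and a fitting tile has a port exactly
    where the label is nonzero. *)
Lemma labelled_bpd v P : (forall i, v i != 0%N) -> labelled v P -> is_bpd P.
Proof.
move=> v0 /and3P[/forallP F /forallP V /forallP T].
have {}F i j : fits (P i j) (in_left P i j) (in_bottom P i j) by have /forallP := F i.
have Fl i j : left_port (P i j) = (in_left P i j != 0%N) by case/andP: (F i j) => /eqP.
have Fb i j : bottom_port (P i j) = (in_bottom P i j != 0%N) by case/andP: (F i j) => _ /eqP.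
apply/and5P; split; last (apply/andP; split); apply/forallP => i; apply/forallP => j.
- apply/forallP => j'; apply/implyP => /eqP e.
  by rewrite (fits_right (F i j)) -in_leftS Fl e.
- apply/forallP => k; apply/implyP => /eqP e.
  by rewrite (fits_top (F j k)) -bottom_label_above Fb /in_bottom e.
- by apply/implyP => /eqP e; rewrite Fl e.
- apply/implyP => /eqP e; rewrite (fits_top (F i j)) -bottom_label_above e subn0.
  by rewrite (eqP (T j)).
- by apply/implyP => /eqP e; rewrite (fits_right (F i j)) -in_leftS e (eqP (V i)).
- by apply/implyP => /eqP e; rewrite Fb /in_bottom e subnn.
Qed.

(** Induction over rows from the bottom and, in [step], over columns from the left: once the
    neighbour fits, the port on the shared edge agrees with its label. *)
Lemma bpd_fits P i j : is_bpd P -> fits (P i j) (in_left P i j) (in_bottom P i j).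
Proof.
case/and5P=> /forallP H1 /forallP H2 /forallP H3 _ /andP[_ /forallP H6].
have step k : (forall l, bottom_port (P k l) = (in_bottom P k l != 0%N)) ->
    forall l, fits (P k l) (in_left P k l) (in_bottom P k l).
  move=> Hb l; rewrite /fits Hb eqxx andbT.
  have [m] := ubnP (nat_of_ord l); elim: m l => // m IH l lm.
  case l0: (nat_of_ord l) => [|l'] in lm *.
    have /forallP/(_ l)/implyP/(_ (introT eqP l0))/negPf -> := H3 k.
    by rewrite /in_left.
  have l'n : (l' < n)%N by have := ltn_ord l; rewrite /= l0; lia.
  have /forallP/(_ (Ordinal l'n))/forallP/(_ l)/implyP/(_ (introT eqP l0))/eqP <- := H1 k.
  rewrite -[l'.+1]/((Ordinal l'n).+1) in_leftS -fits_right //.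
  by rewrite /fits IH //= Hb eqxx.
have [r] : exists r, (i + r.+1 = n)%N.
  by exists (n - i.+1)%N; have := ltn_ord i; lia.
elim: r i j => [|r IH] i j ir; apply: step => l.
  have /forallP/(_ l)/implyP -> := H6 i; last by apply/eqP; lia.
  by rewrite /in_bottom (_ : (n - i.+1 = 0)%N) //; lia.
have i'n : (i.+1 < n)%N by lia.
have /forallP/(_ (Ordinal i'n))/forallP/(_ l)/implyP/(_ (eqxx _))/eqP -> := H2 i.
rewrite (fits_top (IH _ _ _)) /=; last by lia.
by rewrite -bottom_label_above.
Qed.

Lemma labelledE v P : (forall i, v i != 0%N) ->
  labelled v P = is_bpd P && (demazure_product P == [ffun i => v i]).
Proof.
move=> v0; apply/idP/andP => [L|[B /eqP D]].
  split; first exact: labelled_bpd L.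
  case/and3P: L => _ /forallP V _; apply/eqP/ffunP => i; rewrite !ffunE.
  exact/eqP/V.
apply/and3P; split; first by apply/forallP => i; apply/forallP => j; apply: bpd_fits.
  apply/forallP => i; apply/eqP.
  by move/ffunP: D => /(_ i); rewrite !ffunE.
apply/forallP => j; have n0 : (0 < n)%N by case: (n) j => // -[].
have := bottom_label_above P (Ordinal n0) j; rewrite subn0 => ->.
apply/negPn; rewrite -(fits_top (bpd_fits _ _ B)).
by case/and5P: B => _ _ _ /forallP/(_ (Ordinal n0))/forallP/(_ j)/implyP/(_ isT).
Qed.

(** Labels are shifted by one since 0 marks the absence of a pipe; matrices outside [Pipes w]
    contribute 0 by [labelledE]. *)
Lemma sum_Pipes (R : comNzRingType) (X Y : 'I_n -> R) (w : 'S_n) :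
  \sum_(P in Pipes w) \prod_(i < n) \prod_(j < n) tile_weight (X i) (Y j) (P i j) =
  lattice_sum [seq (X (rev_ord r), (w (rev_ord r)).+1) | r <- enum 'I_n]
    [seq Y j | j <- enum 'I_n] (iota 1 n).
Proof.
have sz S (f : 'I_n -> S) : size [seq f i | i <- enum 'I_n] = n.
  by rewrite size_map size_enum_ord.
rewrite (@lattice_sumE _ n n) ?sz ?size_iota //.
rewrite (reindex (@tile_rows n)) /=; last exact/onW_bij/tile_rows_bij.
rewrite big_mkcond /=; apply: eq_bigr => P _.
rewrite (@tiling_weight_matrix n R X Y (fun i => (w i).+1)) labelledE // inE.
by case: ifP => _; rewrite ?mul1r ?mul0r.
Qed.

(** Rests on [1 + beta (x_i ⊕ y_j) = (1 + beta x_i) (1 + beta y_j)]. *)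
Lemma wtE (A : idomainType) (b : A) (y : 'I_n -> A) P :
  wt b y P = \prod_(i < n) \prod_(j < n)
    tile_weight (1 + beta b n * xvar i) (1 + beta b n * yvar y j) (P i j).
Proof.
rewrite pair_big /wt /= big_mkcond [X in _ * X]big_mkcond -big_split /=.
apply: eq_bigr => -[i j] _; rewrite !inE /=.
by case: (P i j) => //=; rewrite /oplus /tile_weight; ring.
Qed.

End Labelled.

(** * Enumeration of rows and permutation length *)

Lemma map_rev_ord n : map (@rev_ord n) (enum 'I_n) = rev (enum 'I_n).
Proof.
case: n => [|n]; first by rewrite [enum _]size0nil ?size_enum_ord.
apply: (@eq_from_nth _ ord0); rewrite size_map ?size_rev // size_enum_ord => i iN.
rewrite (nth_map ord0) ?size_enum_ord // nth_rev ?size_enum_ord //.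
by apply: val_inj; rewrite /= !nth_enum_ord // ltn_subrL.
Qed.

(** Exhibits rows [i] and [j] as neighbours in the list of rows, as [lattice_sum_exchange]
    requires. *)
Lemma enum_ord_split n (i j : 'I_n) : j = i.+1 :> nat ->
  exists2 s : seq 'I_n * seq 'I_n, enum 'I_n = s.1 ++ [:: i, j & s.2]
    & forall k, k \in s.1 ++ s.2 -> k != i /\ k != j.
Proof.
move=> ij.
have e : enum 'I_n = take i (enum 'I_n) ++ [:: i, j & drop i.+2 (enum 'I_n)].
  have dj : drop i.+1 (enum 'I_n) = j :: drop i.+2 (enum 'I_n).
    by rewrite -ij (drop_nth i) ?size_enum_ord // nth_ord_enum.
  have di : drop i (enum 'I_n) = i :: drop i.+1 (enum 'I_n).
    by rewrite (drop_nth i) ?size_enum_ord // nth_ord_enum.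
  by rewrite -dj -di cat_take_drop.
exists (take i (enum 'I_n), drop i.+2 (enum 'I_n)) => //= k.
have := enum_uniq 'I_n; rewrite {1}e => U kin.
have {}U : uniq ([:: i; j] ++ take i (enum 'I_n) ++ drop i.+2 (enum 'I_n)).
  by rewrite (perm_uniq (permEl (perm_catCA _ _ _))).
move: U kin; rewrite /=; move: (_ ++ _) => t; rewrite inE => /and3P[+ + _] kt.
rewrite negb_or => /andP[_ it] jt; split; apply/eqP => ek; move: kt; rewrite ek; exact/negP.
Qed.

Section Length.
Variable n : nat.
Implicit Types (w : 'S_n) (i j : 'I_n).

(** Exchanging [i] and [j] in both coordinates matches the inversions of [tperm i j * w] with those
    of [w] other than [(i, j)]; since the positions are adjacent, no other pair changes order. *)
Lemma perm_length_tperm w i j : j = i.+1 :> nat -> (w j < w i)%N ->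
  perm_length w = (perm_length (tperm i j * w)%g).+1.
Proof.
move=> ij wij; rewrite /perm_length (cardsD1 (i, j)) inE /= wij ij ltnSn add1n.
congr _.+1; pose s := tperm i j; pose f (p : 'I_n * 'I_n) := (s p.1, s p.2).
have f_inj : injective f by move=> [a b] [c d] [/perm_inj -> /perm_inj ->].
rewrite -(card_preimset _ f_inj); apply: eq_card => -[a b].
rewrite !inE /= !permM -/s xpair_eqE.
have nij : (i : nat) != j by lia.
rewrite -!val_eqE /= /s.
by case: tpermP => [->|->|/eqP + /eqP +]; case: tpermP => [->|->|/eqP + /eqP +];
  rewrite -?val_eqE /=; lia.
Qed.

(** Reflecting the second coordinate turns the inversions of [w0] into the index set of the product
    [groth_top]. *)
Lemma perm_length_w0 : perm_length (w0 n) =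
  #|[pred p : 'I_n * 'I_n | (p.1.+1 + p.2.+1 <= n)%N]|.
Proof.
pose f (p : 'I_n * 'I_n) := (p.1, rev_ord p.2).
have f_inj : injective f.
  by move=> [a b] [c d] e; move: (congr1 snd e) (congr1 fst e) => /rev_ord_inj /= -> ->.
rewrite /perm_length -(card_preimset _ f_inj); apply: eq_card => -[a b].
rewrite !inE /= !permE /=.
have := ltn_ord a; have := ltn_ord b; lia.
Qed.

End Length.

(** * Comparison with Grothendieck polynomials *)

Section Main.
Variables (A : idomainType) (b : A) (n : nat) (y : 'I_n -> A).
Hypothesis b0 : b != 0.
Implicit Types (w : 'S_n) (i j : 'I_n).
Local Notation X i := (1 + beta b n * xvar i).
Local Notation Y j := (1 + beta b n * yvar y j).
Local Notation Z w := (\sum_(P in Pipes w) wt b y P).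

Lemma sum_wtE w : Z w =
  lattice_sum [seq (X i, (w i).+1) | i <- rev (enum 'I_n)]
    [seq Y j | j <- enum 'I_n] (iota 1 n).
Proof.
under eq_bigr do rewrite wtE.
by rewrite sum_Pipes -map_rev_ord -map_comp.
Qed.

(** The right labels of [w0] increase from bottom to top, so the state is frozen; its blanks are the
    cells of [groth_top], each giving one factor beta. *)
Lemma sum_wt_top : Z (w0 n) = beta b n ^+ perm_length (w0 n) * groth_top b y.
Proof.
rewrite sum_wtE -map_rev_ord -map_comp.
have -> : [seq ((fun i => (X i, ((w0 n) i).+1)) \o @rev_ord n) i | i <- enum 'I_n] =
    zip [seq X (rev_ord i) | i <- enum 'I_n] (iota 1 n).
  have -> : iota 1 n = [seq (val i).+1 | i <- enum 'I_n].
    by rewrite -[1%N]/(1 + 0)%N iotaDl -val_enum_ord -map_comp.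
  rewrite zip_map; apply: eq_map => i /=.
  by rewrite permE rev_ordK.
have sz S (f : 'I_n -> S) : size [seq f i | i <- enum 'I_n] = n.
  by rewrite size_map size_enum_ord.
rewrite [LHS](@lattice_sum_frozen _ _ _ 0 n) ?sz //.
rewrite (reindex_inj rev_ord_inj) perm_length_w0 -prodr_const.
rewrite (eq_bigl (fun p : 'I_n * 'I_n => true && (p.1.+1 + p.2.+1 <= n)%N)) //.
rewrite -(pair_big_dep xpredT (fun i j : 'I_n => i.+1 + j.+1 <= n)%N (fun _ _ => beta b n)) /=.
rewrite /groth_top -big_split; apply: eq_bigr => i _ /=.
rewrite -big_split /= add0n (nth_map i) ?size_enum_ord ?rev_ord_proof //.
have -> : nth i (enum 'I_n) (n - i.+1) = rev_ord i.
  exact: (nth_ord_enum i (rev_ord i)).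
rewrite rev_ordK (big_nth 0) size_take sz rev_ord_proof.
rewrite (big_nat_widen _ _ n) ?leq_subr // big_mkord.
apply: eq_big => [j|j jn]; first by lia.
rewrite nth_take // (nth_map i) ?size_enum_ord // nth_ord_enum.
by rewrite /oplus; ring.
Qed.

(** This is [lattice_sum_exchange] with [a = X i] and [b = X j]: row [j] is the lower one and has
    the smaller label, and [msym] puts [X i] on it. *)
Lemma sum_wt_step w i j : j = i.+1 :> nat -> (w j < w i)%N ->
  X i * msym (tperm i j) (Z w) = X j * Z w - (X i - X j) * Z (tperm i j * w)%g.
Proof.
move=> ij wij; set s := tperm i j.
have [[s1 s2] /= e sN] := enum_ord_split ij.
have sK k : k \in s1 ++ s2 -> s k = k.
  by case/sN => ki kj; rewrite /s tpermD // eq_sym.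
have sK1 k : k \in rev s1 -> s k = k by rewrite mem_rev => ks; rewrite sK ?mem_cat ?ks.
have sK2 k : k \in rev s2 -> s k = k.
  by rewrite mem_rev => ks; rewrite sK ?mem_cat ?ks ?orbT.
have si : s i = j by rewrite /s tpermL.
have sj : s j = i by rewrite /s tpermR.
have msX k : msym s (X k) = X (s k).
  by rewrite msymD msym1 msymM msym_beta msym_xvar.
rewrite !sum_wtE rmorph_lattice_sum e rev_cat !rev_cons !cat_rcons -!map_comp.
have -> : [seq (msym s \o (fun k => Y k)) k | k <- s1 ++ [:: i, j & s2]] =
    [seq Y k | k <- s1 ++ [:: i, j & s2]].
  by apply: eq_map => k; rewrite /= msymD msym1 msymM msym_beta msymC.
rewrite !map_cat /= msX msX !permM si sj.
have m1 (t : seq 'I_n) : {in t, forall k, s k = k} ->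
    [seq ((fun u => (msym s u.1, u.2)) \o (fun k => (X k, (w k).+1))) k | k <- t] =
    [seq (X k, (w k).+1) | k <- t].
  by move=> tK; apply/eq_in_map => k kt; rewrite /= msX tK.
have m2 (t : seq 'I_n) : {in t, forall k, s k = k} ->
    [seq (X k, ((s * w)%g k).+1) | k <- t] = [seq (X k, (w k).+1) | k <- t].
  by move=> tK; apply/eq_in_map => k kt; rewrite permM tK.
rewrite !m1 // !m2 //; apply: lattice_sum_exchange => //.
  by have := size_enum_ord n; rewrite e !size_cat size_iota /= !size_map.
exact/filter_uniq/iota_uniq.
Qed.

Lemma is_groth_sum_wt w f : is_groth b y w f -> beta b n ^+ perm_length w * f = Z w.
Proof.
elim=> [|{}w i j {}f ij wij _ IH]; first by rewrite sum_wt_top.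
have beta0 : beta b n != 0 by rewrite /beta mpolyC_eq0.
have nij : i != j by rewrite -val_eqE /= ij; lia.
(* This factor is [X i - X j], the coefficient of the new partition function in [sum_wt_step]; it
   also clears the denominator of [demazure]. *)
have s0 : beta b n * (xvar i - xvar j) != 0 by rewrite mulf_neq0 // xvar_sub_neq0.
apply: (mulfI s0).
have := sum_wt_step ij wij; rewrite -IH msymM.
have -> : msym (tperm i j) (beta b n ^+ perm_length w) = beta b n ^+ perm_length w.
  by rewrite /beta -rmorphXn /= msymC.
rewrite (perm_length_tperm ij wij) exprS => E.
set m := perm_length _ in E *.
have := demazureE b i j f; rewrite /demazure_num => D.
transitivity (beta b n * beta b n ^+ m * ((xvar i - xvar j) * demazure b i j f)); first by ring.
rewrite D; move: E; set T := \sum_(P in _) _; move=> E.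
have -> : beta b n * (xvar i - xvar j) * T = (X i - X j) * T by ring.
have -> : (X i - X j) * T = X j * (beta b n * beta b n ^+ m * f) -
   X i * (beta b n * beta b n ^+ m * msym (tperm i j) f) by rewrite E; ring.
by ring.
Qed.

End Main.

Theorem theorem1p1 (n : nat) (n_ge1 : (1 <= n)%N) (w : 'S_n) :
  to_laurent (grothendieck w) =
  ((lbeta ^- perm_length w)%:MP)%:MP * \sum_(P in Pipes w) to_laurent (pipe_weight P).
Proof.
have X0 : ('X%:MP : {mpoly {poly int}[n]}) != 0 by rewrite mpolyC_eq0 polyX_eq0.
(* The identity with [beta ^+ perm_length w] on the left holds before inverting beta; its image is
   then cancelled by [lbeta ^- perm_length w]. *)
rewrite /to_laurent -rmorph_sum -(is_groth_sum_wt X0 (grothP _ _ w)) rmorphM rmorphXn /=.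
rewrite map_mpolyC /= map_mpolyC -!rmorphXn /= mulrA -!mpolyCM mulVr ?mpolyC1 ?mul1r //.
by rewrite rmorphXn unitrX // lbeta_unit.
Qed.
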